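(* For every integer $n\ge 1$, $$\sum_{r=1}^n\ \sum_{\substack{k_1,\dots,k_r\ge 1\\ k_1+\dots+k_r=n}} \frac{n!}{k_1!\,k_2!\cdots k_r!}\;k_1^{k_2}k_2^{k_3}\cdots k_{r-1}^{k_r}=(n+1)^{n-1}.$$
   Context: The inner sum runs over all ordered $r$-tuples $(k_1,\dots,k_r)$ of positive integers with sum $n$. For $r=1$ the product $k_1^{k_2}\cdots k_{r-1}^{k_r}=\prod_{l=2}^r k_{l-1}^{k_l}$ is empty and equals $1$. *)

(* Defs.v *)
From mathcomp Require Import all_boot all_order all_algebra.
Set Implicit Arguments.
Unset Strict Implicit.
Unset Printing Implicit Defensive.

(* Ordered r-tuples of positive integers with sum n. A part of such a tuple is
   at most n, so taking the entries in 'I_n.+1 excludes none of them. *)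
Definition compositions (n r : nat) : {set r.-tuple 'I_n.+1} :=
  [set k : r.-tuple 'I_n.+1 |
    [forall i, 0 < tnth k i] && (\sum_(i < r) tnth k i == n)].

(* Main.v *)
Require Import Defs.
From mathcomp Require Import all_boot all_order all_algebra.
From mathcomp Require Import ring zify.
Import GRing.Theory.
Local Open Scope ring_scope.

(** Prepend an entry [k_0 = m] to a composition [(k_1, ..., k_r)] of [n].  Then
    [n`! \prod_l k_(l-1) ^+ k_l / k_l`!] counts the forests on [m] given roots
    and [n] further labelled vertices that have [k_l] vertices at depth [l]:
    the multinomial coefficient chooses the levels, and each vertex of level
    [l] picks a parent in level [l-1].  Hence the total [W m n] over all
    compositions of all lengths is the number of such forests, which is
    [m (m + n) ^+ n.-1]; for [m = 1] these are the trees on [n.+1] vertices, and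
    the theorem is Cayley's formula refined by levels.

    The closed form is proved algebraically.  Removing the first level gives
    [W m n = \sum_(1 <= k <= n) 'C(n, k) m ^+ k W k (n - k)]; divided by [n`!]
    and read off for one length at a time, this is [chain_sum_recl].  In the
    closed form for [W k (n - k)] the base [k + (n - k) = n] does not depend on
    [k], so together with [k 'C(n, k) = n 'C(n.-1, k.-1)] the sum becomes the
    binomial expansion of [m (m + n) ^+ n.-1] ([forest_number_rec]).  An
    induction on a bound for the length concludes ([sum_chain_sum]). *)

Fixpoint chain_weight (m : nat) (s : seq nat) : rat :=
  if s is k :: s' then m%:R ^+ k / (k`!)%:R * chain_weight k s' else 1.

Definition composes (n : nat) (s : seq nat) : bool :=
  all (leq 1) s && (sumn s == n).

(** The bound [N] on the entries is kept apart from the total [n], so that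
    removing an entry, which lowers the total, leaves the index type alone. *)
Definition chain_sum (N r m n : nat) : rat :=
  \sum_(t : r.-tuple 'I_N.+1 | composes n (map val t))
     chain_weight m (map val t).

(** The number [m (m + n) ^+ n.-1] of forests on [m] given roots and [n] further
    vertices, divided by [n`!].  With [n.-1] traded for a division the formula
    gives the correct value [1] at [n = 0] when [m] is positive. *)
Definition forest_number (m n : nat) : rat :=
  m%:R / (m + n)%:R * (m + n)%:R ^+ n / (n`!)%:R.

Lemma natr_rat_neq0 (n : nat) : (0 < n)%N -> n%:R != 0 :> rat.
Proof. by rewrite Num.Theory.pnatr_eq0 lt0n. Qed.

Lemma factr_rat_neq0 (n : nat) : (n`!)%:R != 0 :> rat.
Proof. exact/natr_rat_neq0/fact_gt0. Qed.

Lemma chain_weightE (m : nat) (s : seq nat) :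
  chain_weight m s =
  (\prod_(l < size s) (nth 0 (m :: s) l)%:R ^+ nth 0 s l)
    / \prod_(l < size s) ((nth 0 s l)`!)%:R.
Proof.
elim: s m => [|k s IHs] m; first by rewrite !big_ord0 divr1.
by rewrite /= !big_ord_recl /= IHs invfM mulrACA.
Qed.

Lemma composes_cons (n k : nat) (s : seq nat) :
  composes n (k :: s) = (0 < k <= n)%N && composes (n - k) s.
Proof.
rewrite /composes /=; case: (0 < k)%N; case: (all _ s); rewrite ?andbF //=.
by apply/eqP/andP => [<-|[le_kn /eqP->]]; rewrite ?leq_addr ?addKn ?subnKC.
Qed.

Lemma chain_sum0l (N m n : nat) : chain_sum N 0 m n = (n == 0)%:R.
Proof.
rewrite /chain_sum big_mkcond (big_pred1 [tuple]) => [|t]; last first.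
  by apply/esym/eqP; apply: tuple0.
by rewrite /composes /= eq_sym; case: eqP.
Qed.

(** A tuple of length [r.+1] is its head [k] and its tail, and the tail is
    weighted as a chain hung below [k]. *)
Lemma chain_sum_recl (N r m n : nat) :
  chain_sum N r.+1 m n =
  \sum_(k < N.+1 | (0 < k <= n)%N)
     m%:R ^+ k / (k`!)%:R * chain_sum N r k (n - k).
Proof.
under eq_bigr => k _ do rewrite /chain_sum big_distrr /=.
rewrite pair_big_dep /chain_sum.
rewrite (reindex (fun p : 'I_N.+1 * r.-tuple 'I_N.+1 => [tuple of p.1 :: p.2])).
  by apply: eq_bigl => -[k t] /=; rewrite composes_cons.
exists (fun t => (thead t, [tuple of behead t])) => [[k t] _|t _] /=.
  by congr pair; apply: val_inj.
by rewrite -tuple_eta.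
Qed.

(** With [k / n * n ^+ (n - k) / (n - k)`!] for [forest_number k (n - k)], the
    [k]-th term is [m / n`!] times ['C(n.-1, k.-1) m ^+ k.-1 n ^+ (n - k)], a term
    of the expansion of [(n + m) ^+ n.-1]. *)
Lemma forest_number_rec (m n : nat) : (0 < n)%N ->
  \sum_(1 <= k < n.+1) m%:R ^+ k / (k`!)%:R * forest_number k (n - k)
  = forest_number m n.
Proof.
case: n => // n _; rewrite big_add1 /= big_mkord.
have nz1 := natr_rat_neq0 n.+1 isT.
have nz2 : (m + n.+1)%:R != 0 :> rat by apply: natr_rat_neq0; rewrite addnS.
transitivity (m%:R / (n.+1`!)%:R * (n.+1%:R + m%:R) ^+ n : rat).
  rewrite exprDn big_distrr; apply: eq_bigr => -[k ltkn] _ /=.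
  have lekn : (k <= n)%N by [].
  rewrite /forest_number subSS addSn subnKC // -mulr_natl.
  have fn : (n`!)%:R = 'C(n, k)%:R * ((k`!)%:R * ((n - k)`!)%:R) :> rat.
    by rewrite -!natrM bin_fact.
  have C0 : 'C(n, k)%:R != 0 :> rat by apply: natr_rat_neq0; rewrite bin_gt0.
  have f1 := factr_rat_neq0 k; have f2 := factr_rat_neq0 (n - k).
  have k0 := natr_rat_neq0 k.+1 isT.
  rewrite !factS !natrM fn exprS; field.
  by rewrite !nat1r f1 f2 C0 k0 nz1.
rewrite /forest_number natrD addrC -natrD exprS.
have := factr_rat_neq0 n.+1 => f1; field.
by rewrite f1 nat1r -natrD nz2.
Qed.

(** Removing the first entry shortens a tuple by one and lowers its total by at
    least one, so the hypothesis that the total is at most the length bound [R]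
    survives the induction on [R]; it ensures that no length is missed. *)
Lemma sum_chain_sum (N R m n : nat) :
  (0 < m)%N -> (n <= R)%N -> (n <= N)%N ->
  \sum_(r < R.+1) chain_sum N r m n = forest_number m n.
Proof.
have init k : (0 < k)%N -> forest_number k 0 = 1.
  by move=> k0; rewrite /forest_number addn0 divff ?natr_rat_neq0 // expr0 fact0 !divr1.
elim: R m n => [|R IHR] m n m_gt0 le_nR le_nN.
  by move: le_nR; rewrite leqn0 big_ord1 chain_sum0l => /eqP->; rewrite init.
rewrite big_ord_recl chain_sum0l.
under eq_bigr => r _ do rewrite chain_sum_recl.
rewrite exchange_big /=.
under eq_bigr => k /andP[k_gt0 le_kn].
  rewrite -big_distrr /= IHR //; [over|lia|lia].
case: n => [|n] in le_nR le_nN *.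
  by rewrite init // big1 ?addr0 // => k; lia.
rewrite add0r -[RHS]forest_number_rec //.
rewrite -(big_mkord (fun k => (0 < k <= n.+1)%N)
  (fun k => m%:R ^+ k / (k`!)%:R * forest_number k (n.+1 - k))).
rewrite (big_ltn_cond (ltn0Sn N)) /=.
rewrite [RHS](big_nat_widen _ _ N.+1) //; apply: congr_big_nat => // k.
by rewrite ltnS; case: k.
Qed.

Theorem theorem2p1 (n : nat) (n_ge1 : (1 <= n)%N) :
  \sum_(1 <= r < n.+1) \sum_(k in compositions n r)
     ((n`!)%:R / (\prod_(i < r) ((tnth k i)`!)%:R)
      * \prod_(1 <= l < r) (nth ord0 k l.-1)%:R ^+ (nth ord0 k l))
  = (n.+1)%:R ^+ n.-1 :> rat.
Proof.
transitivity ((n`!)%:R * \sum_(r < n.+1) chain_sum n r 1 n).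
  (* Length [0] contributes nothing on the right: the empty tuple is no
     composition of a positive [n]. *)
  rewrite big_ord_recl chain_sum0l gtn_eqF // add0r big_distrr /=.
  rewrite big_add1 big_mkord; apply: eq_bigr => r _.
  rewrite /bump add1n /chain_sum big_distrr; apply: eq_big => [t|t _].
    rewrite inE /composes; congr andb.
      rewrite all_map; apply/forallP/allP => [pos x /tnthP[i ->]|pos i].
        exact: pos.
      exact: pos (mem_tnth i t).
    by rewrite sumnE big_map big_tuple.
  have nthE l : (l < r.+1)%N -> nth 0%N (map val t) l = nth ord0 t l.
    by move=> ltlr; rewrite (nth_map ord0) ?size_tuple.
  rewrite chain_weightE size_map size_tuple -mulrA; congr (_ * _).
  rewrite mulrC; congr (_ / _); last first.
    by apply: eq_bigr => i _; rewrite nthE // (tnth_nth ord0).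
  (* The prepended entry [1] contributes only the factor [1 ^+ k_1]. *)
  rewrite big_add1 big_mkord big_ord_recl /= expr1n mul1r.
  apply: eq_bigr => i _; rewrite /bump add0n add1n /= !nthE ?ltnS //.
  exact: ltnW (ltn_ord i).
rewrite sum_chain_sum // /forest_number add1n.
case: n n_ge1 => // n _; rewrite exprS /=.
have := factr_rat_neq0 n.+1 => f0; have := natr_rat_neq0 n.+2 isT => n0.
by rewrite mul1r mulKf // mulrC divfK.
Qed.
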